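(* Let $H_0,H_1>0$ and let $f:\mathbb{R}^d\to\mathbb{R}$ be $(H_0,H_1)$-smooth and convex. Let $\theta=\frac1{4\sqrt2+4}$, and let $x^0,\dots,x^N$ be generated by gradient descent with the warm-up step size $\eta_k=\theta\min\left\{\frac1{H_0},\frac1{3H_1F_k}\right\}$, where $F_k=f(x^k)-f^*$. Let $$T:=\min\left\{k\in\{0,\dots,N-1\}:\ F_k<\frac{H_0}{3H_1}\right\},$$ with the convention $T=N$ if this set is empty, and let $R=\|x^0-x^*\|$. If $T<N$, then $$f(x^N)-f^*\le\min\left\{\left(1-\frac{\theta}{6H_1R^2}\right)^TF_0,\ \frac{2H_0R^2}{\theta(N-T)}\right\}.$$ If $T=N$, then $$f(x^N)-f^*\le\left(1-\frac{\theta}{6H_1R^2}\right)^NF_0.$$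
   Context: $f$ is differentiable on $\mathbb{R}^d$, $f^*=\min_xf(x)$, $x^*\in\arg\min f$; $\|\cdot\|$ is the Euclidean norm. $(H_0,H_1)$-smoothness: for all $x,y\in\mathbb{R}^d$ with $\|y-x\|\le1/\sqrt{H_1}$, $\|\nabla f(y)-\nabla f(x)\|\le\big(H_0+H_1[f(x)-f^*]\big)\|y-x\|$. Convexity: $f(x)-f(y)\le\langle\nabla f(x),x-y\rangle$ for all $x,y$. Gradient descent: $x^0\in\mathbb{R}^d$ is given and $x^{k+1}=x^k-\eta_k\nabla f(x^k)$ for $k=0,\dots,N-1$, with the convention $\frac1{3H_1F_k}=+\infty$ (so $\eta_k=\theta/H_0$) when $F_k=0$. *)

(* Defs.v *)
From HB Require Import structures.
From mathcomp Require Import all_boot all_order all_algebra.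
From mathcomp Require Import all_classical all_reals all_analysis.

Set Implicit Arguments.
Unset Strict Implicit.
Unset Printing Implicit Defensive.

Import Order.TTheory GRing.Theory Num.Theory.
Import numFieldNormedType.Exports.

Local Open Scope classical_set_scope.
Local Open Scope ring_scope.

(* The library norm on 'rV[R]_d is the sup norm, hence a separate Euclidean
   norm.  The two norms induce the same topology, so the library's
   [differentiable] is the usual differentiability on R^d. *)
Definition dotv (R : realType) (d : nat) (u v : 'rV[R]_d) : R :=
  \sum_(i < d) u 0 i * v 0 i.

Definition enorm (R : realType) (d : nat) (u : 'rV[R]_d) : R :=
  Num.sqrt (dotv u u).

Definition grad (R : realType) (d : nat) (f : 'rV[R]_d -> R) (x : 'rV[R]_d) :
    'rV[R]_d :=
  \row_(i < d) 'D_(delta_mx 0 i) f x.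

Definition is_min_value (R : realType) (d : nat) (f : 'rV[R]_d -> R) (m : R) :=
  range f m /\ lbound (range f) m.

Definition argmin (R : realType) (d : nat) (f : 'rV[R]_d -> R) :
    set 'rV[R]_d :=
  [set x | forall y, f x <= f y].

(* [fs] stands for the minimum value f^* of [f]. *)
Definition H0H1_smooth (R : realType) (d : nat) (H0 H1 : R)
    (f : 'rV[R]_d -> R) (fs : R) :=
  forall x y : 'rV[R]_d, enorm (y - x) <= 1 / Num.sqrt H1 ->
    enorm (grad f y - grad f x) <= (H0 + H1 * (f x - fs)) * enorm (y - x).

(* First-order convexity; used together with differentiability of [f]. *)
Definition convex_grad (R : realType) (d : nat) (f : 'rV[R]_d -> R) :=
  forall x y : 'rV[R]_d, f x - f y <= dotv (grad f x) (x - y).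

Definition theta (R : realType) : R := 1 / (4 * Num.sqrt 2 + 4).

(* The test [Fk == 0] implements the convention 1 / (3 H1 Fk) = +oo when
   Fk = 0, which the total inverse of the library (0^-1 = 0) does not. *)
Definition warmup_step (R : realType) (H0 H1 Fk : R) : R :=
  theta R *
    (if Fk == 0 then 1 / H0 else Num.min (1 / H0) (1 / (3 * H1 * Fk))).

Definition gradient_descent (R : realType) (d : nat) (f : 'rV[R]_d -> R)
    (eta : nat -> R) (N : nat) (x : nat -> 'rV[R]_d) :=
  forall k : nat, (k < N)%N -> x k.+1 = x k - eta k *: grad f (x k).

(* The least k < N with F k < H0 / (3 H1); the unit N of the iterated minimum
   is returned when there is no such k, and exceeds every candidate k. *)
Definition warmup_time (R : realType) (H0 H1 : R) (F : nat -> R) (N : nat) :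
    nat :=
  \big[minn/N]_(k < N | F k < H0 / (3 * H1)) (k : nat).

(* Main.v *)
Require Import Defs.
From HB Require Import structures.
From mathcomp Require Import all_boot all_order all_algebra.
From mathcomp Require Import all_classical all_reals all_analysis.
From mathcomp Require Import ring lra.

Set Implicit Arguments.
Unset Strict Implicit.
Unset Printing Implicit Defensive.

Import Order.TTheory GRing.Theory Num.Theory.
Import numFieldNormedType.Exports.

Local Open Scope classical_set_scope.
Local Open Scope ring_scope.

(** Write F = f x - fs and L = H0 + H1 F.  Inside the ball of radius
    1 / sqrt H1 around x, f lies below a quadratic with curvature of order L
    ([H0H1_descent]).  Since f cannot go below its minimum there, this forces
    |grad f x|^2 <= 4 L F ([sqr_enorm_grad_le]).

    The warm-up step eta satisfies eta L <= 4 theta / 3 and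
    eta H1 F <= theta / 3 ([warmup_step_bounds]).  With the gradient bound, this
    keeps every step inside the ball and yields two estimates valid at every
    iteration: f decreases by at least (eta / 2) |grad f x|^2
    ([short_step_decrease]), and the squared distance to the minimizer decreases
    by at least eta F ([short_step_dist]).  In particular the distance to the
    minimizer never exceeds its initial value r, so that convexity gives
    |grad f x| >= F / r.

    While F >= H0 / (3 H1), the step is theta / (3 H1 F), and the first estimate
    contracts F by the factor 1 - theta / (6 H1 r^2) ([large_gap_contraction]).
    F is nonincreasing, so from the warm-up time T on the step is the constant
    theta / H0; summing the second estimate over T <= k < N then bounds
    (N - T) (theta / H0) F_N by r^2 ([telescoping_rate]). *)

(** * Euclidean geometry of row vectors *)

Lemma dotvC (R : realType) (d : nat) (u v : 'rV[R]_d) : dotv u v = dotv v u.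
Proof. by apply: eq_bigr => i _; rewrite mulrC. Qed.

Lemma dotvDr (R : realType) (d : nat) (u v w : 'rV[R]_d) :
  dotv u (v + w) = dotv u v + dotv u w.
Proof. by rewrite /dotv -big_split; apply: eq_bigr => i _; rewrite mxE mulrDr. Qed.

Lemma dotvZr (R : realType) (d : nat) (a : R) (u v : 'rV[R]_d) :
  dotv u (a *: v) = a * dotv u v.
Proof. by rewrite /dotv mulr_sumr; apply: eq_bigr => i _; rewrite mxE mulrCA. Qed.

Lemma dotvNr (R : realType) (d : nat) (u v : 'rV[R]_d) :
  dotv u (- v) = - dotv u v.
Proof. by rewrite -scaleN1r dotvZr mulN1r. Qed.

Lemma dotvv_ge0 (R : realType) (d : nat) (u : 'rV[R]_d) : 0 <= dotv u u.
Proof. by apply: sumr_ge0 => i _; rewrite -expr2 sqr_ge0. Qed.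

Lemma dotvv_eq0 (R : realType) (d : nat) (u : 'rV[R]_d) :
  dotv u u = 0 -> u = 0.
Proof.
move=> /eqP; rewrite psumr_eq0 => [/allP u0|i _]; last by rewrite -expr2 sqr_ge0.
apply/rowP => i; rewrite mxE; apply/eqP.
by have := u0 i (mem_index_enum i); rewrite /= mulf_eq0 orbb.
Qed.

Lemma enorm_ge0 (R : realType) (d : nat) (u : 'rV[R]_d) : 0 <= enorm u.
Proof. exact: sqrtr_ge0. Qed.

Lemma sqr_enorm (R : realType) (d : nat) (u : 'rV[R]_d) :
  enorm u ^+ 2 = dotv u u.
Proof. by rewrite /enorm sqr_sqrtr // dotvv_ge0. Qed.

Lemma enormZ (R : realType) (d : nat) (a : R) (u : 'rV[R]_d) :
  enorm (a *: u) = `|a| * enorm u.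
Proof.
rewrite /enorm dotvZr dotvC dotvZr mulrA -expr2 sqrtrM ?sqr_ge0 //.
by rewrite sqrtr_sqr.
Qed.

Lemma dotv_sqr_le (R : realType) (d : nat) (u v : 'rV[R]_d) :
  dotv u v ^+ 2 <= dotv u u * dotv v v.
Proof.
have [v0|v0] := eqVneq (dotv v v) 0.
  by rewrite (dotvv_eq0 v0) -(scale0r u) !dotvZr !mul0r expr0n mulr0.
have vgt0 : 0 < dotv v v by rewrite lt_def v0 dotvv_ge0.
(* The residual of projecting u on v, scaled by v.v to avoid a division. *)
have := dotvv_ge0 (dotv v v *: u - dotv u v *: v).
set w := _ - _.
have -> : dotv w w = dotv v v * (dotv u u * dotv v v - dotv u v ^+ 2).
  rewrite {2}/w dotvDr dotvNr !dotvZr !(dotvC w) /w !dotvDr !dotvNr !dotvZr.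
  by rewrite (dotvC v u); ring.
by rewrite pmulr_rge0 // subr_ge0.
Qed.

Lemma dotv_le_enorm (R : realType) (d : nat) (u v : 'rV[R]_d) :
  dotv u v <= enorm u * enorm v.
Proof.
apply: (le_trans (ler_norm _)).
rewrite -(@ler_pXn2r _ 2) ?nnegrE ?mulr_ge0 ?enorm_ge0 //.
by rewrite exprMn !sqr_enorm real_normK ?num_real // dotv_sqr_le.
Qed.

(** * Local descent and the gradient bound *)

(** Convexity at y bounds f y - f x by the slope at y, and smoothness replaces
    that slope by the one at x.  Integrating along the segment would halve the
    quadratic term; the constants below leave room for the cruder bound. *)
Lemma H0H1_descent (R : realType) (d : nat) (H0 H1 : R) (f : 'rV[R]_d -> R)
    (fs : R) (x y : 'rV[R]_d) :
  H0H1_smooth H0 H1 f fs -> convex_grad f ->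
  enorm (y - x) <= 1 / Num.sqrt H1 ->
  f y <= f x + dotv (grad f x) (y - x)
         + (H0 + H1 * (f x - fs)) * enorm (y - x) ^+ 2.
Proof.
move=> fsm fcv hxy.
have fyx := fcv y x.
have slope : dotv (grad f y) (y - x) = dotv (grad f x) (y - x)
    + dotv (grad f y - grad f x) (y - x).
  by rewrite ![dotv _ (y - x)]dotvC -dotvDr (addrC (grad f x)) subrK.
have := dotv_le_enorm (grad f y - grad f x) (y - x).
have := ler_wpM2r (enorm_ge0 (y - x)) (fsm x y hxy).
rewrite -mulrA -expr2; lra.
Qed.

Lemma H0H1_gradient_step (R : realType) (d : nat) (H0 H1 : R)
    (f : 'rV[R]_d -> R) (fs t : R) (x : 'rV[R]_d) :
  H0H1_smooth H0 H1 f fs -> convex_grad f ->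
  0 <= t -> t * enorm (grad f x) <= 1 / Num.sqrt H1 ->
  f (x - t *: grad f x) <=
    f x - t * (1 - t * (H0 + H1 * (f x - fs))) * enorm (grad f x) ^+ 2.
Proof.
move=> fsm fcv t0 ht.
have eqv : (x - t *: grad f x) - x = (- t) *: grad f x.
  by rewrite addrC addKr scaleNr.
have nv : enorm ((- t) *: grad f x) = t * enorm (grad f x).
  by rewrite enormZ normrN ger0_norm.
have := @H0H1_descent _ _ _ _ _ _ x (x - t *: grad f x) fsm fcv.
rewrite eqv nv => /(_ ht); rewrite dotvZr -sqr_enorm.
by move/le_trans; apply; rewrite le_eqVlt; apply/orP; left; apply/eqP; ring.
Qed.

(** A step of length at most 1 / sqrt H1 against the gradient cannot go below
    the minimum.  The step 1 / (2 L), with L = H0 + H1 (f x - fs), is the best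
    one; when it is too long, the step of length exactly 1 / sqrt H1 bounds the
    gradient norm by 2 sqrt H1 (f x - fs), and H1 (f x - fs) <= L. *)
Lemma sqr_enorm_grad_le (R : realType) (d : nat) (H0 H1 : R)
    (f : 'rV[R]_d -> R) (fs : R) (x : 'rV[R]_d) :
  0 < H0 -> 0 < H1 -> lbound (range f) fs ->
  H0H1_smooth H0 H1 f fs -> convex_grad f ->
  enorm (grad f x) ^+ 2 <= 4 * (H0 + H1 * (f x - fs)) * (f x - fs).
Proof.
move=> H0p H1p fsl fsm fcv.
have fge y : fs <= f y by apply: fsl; exists y.
have F0 : 0 <= f x - fs by rewrite subr_ge0.
have step t := @H0H1_gradient_step _ _ _ _ _ _ t x fsm fcv.
move: step; set F := f x - fs in F0 *; set n := enorm (grad f x) => step.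
set L := H0 + H1 * F in step *.
have HF : 0 <= H1 * F by rewrite mulr_ge0 // ltW.
have Lp : 0 < L by rewrite /L; lra.
have sp : 0 < Num.sqrt H1 by rewrite sqrtr_gt0.
have s2 : Num.sqrt H1 ^+ 2 = H1 by rewrite sqr_sqrtr // ltW.
set s := Num.sqrt H1 in step sp s2.
have n0 : 0 <= n := enorm_ge0 _.
have drop t : 0 <= t -> t * n <= 1 / s -> t * (1 - t * L) * n ^+ 2 <= F.
  move=> t0 tn; have := step t t0 tn; have := fge (x - t *: grad f x).
  rewrite /F; lra.
have [small|big] := lerP (n * s) (2 * L).
  have t0 : 0 <= (2 * L)^-1 by rewrite invr_ge0; lra.
  have tn : (2 * L)^-1 * n <= 1 / s.
    by rewrite ler_pdivlMr // -mulrA ler_pdivrMl ?mulr1; lra.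
  have := drop _ t0 tn.
  have -> : (2 * L)^-1 * (1 - (2 * L)^-1 * L) * n ^+ 2 = n ^+ 2 / (4 * L).
    by field; rewrite gt_eqF.
  by rewrite ler_pdivrMr; [rewrite mulrC | lra].
have np : 0 < n by rewrite -(pmulr_lgt0 _ sp); lra.
have t0 : 0 <= (n * s)^-1 by rewrite invr_ge0 mulr_ge0 // ltW.
have tn : (n * s)^-1 * n <= 1 / s.
  by rewrite le_eqVlt; apply/orP; left; apply/eqP; field; rewrite !gt_eqF.
have := drop _ t0 tn.
have -> : (n * s)^-1 * (1 - (n * s)^-1 * L) * n ^+ 2 = (n * s - L) / s ^+ 2.
  by field; rewrite !gt_eqF.
rewrite s2 ler_pdivrMr // => nsF.
have ns2F : n * s <= 2 * (F * H1) by lra.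
have n2s2 : n ^+ 2 * H1 <= 4 * F ^+ 2 * H1 * H1.
  rewrite -s2 -exprMn s2.
  have -> : 4 * F ^+ 2 * H1 * H1 = (2 * (F * H1)) ^+ 2 by ring.
  by rewrite ler_pXn2r ?nnegrE //; [rewrite mulr_ge0 // ltW | lra].
rewrite ler_pM2r // in n2s2; apply: (le_trans n2s2).
have -> : 4 * L * F = 4 * F ^+ 2 * H1 + 4 * (H0 * F) by rewrite /L; ring.
by have := mulr_ge0 (ltW H0p) F0; lra.
Qed.

(** * One step of gradient descent *)

(** The gradient bound makes the step short enough for the local descent
    inequality: with L = H0 + H1 (f x - fs), its squared length is at most
    4 (eta L) (eta (f x - fs)), hence at most 1 / (36 H1). *)
Lemma short_step_decrease (R : realType) (d : nat) (H0 H1 : R)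
    (f : 'rV[R]_d -> R) (fs eta : R) (x : 'rV[R]_d) :
  0 < H0 -> 0 < H1 -> lbound (range f) fs ->
  H0H1_smooth H0 H1 f fs -> convex_grad f ->
  0 <= eta -> eta * (H0 + H1 * (f x - fs)) <= 1 / 6 ->
  eta * H1 * (f x - fs) <= 1 / 24 ->
  f (x - eta *: grad f x) <= f x - eta / 2 * enorm (grad f x) ^+ 2.
Proof.
move=> H0p H1p fsl fsm fcv e0 eL eF.
have F0 : 0 <= f x - fs by rewrite subr_ge0; apply: fsl; exists x.
have gb := sqr_enorm_grad_le x H0p H1p fsl fsm fcv.
have n0 := enorm_ge0 (grad f x).
have step := @H0H1_gradient_step _ _ _ _ _ _ eta x fsm fcv e0.
have len : eta * enorm (grad f x) <= 1 / Num.sqrt H1.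
  have sp : 0 < Num.sqrt H1 by rewrite sqrtr_gt0.
  rewrite ler_pdivlMr // -(@ler_pXn2r _ 2) ?nnegrE ?mulr_ge0 ?mulr_ge0 ?sqrtr_ge0 //.
  rewrite !exprMn expr1n (@sqr_sqrtr _ H1) ?(ltW H1p) //.
  have := ler_wpM2l (mulr_ge0 (sqr_ge0 eta) (ltW H1p)) gb.
  have := ler_pM (mulr_ge0 e0 (addr_ge0 (ltW H0p) (mulr_ge0 (ltW H1p) F0)))
                 (mulr_ge0 (mulr_ge0 e0 (ltW H1p)) F0) eL eF.
  lra.
have := step len.
have := ler_wpM2r (mulr_ge0 e0 (sqr_ge0 (enorm (grad f x)))) eL.
have := mulr_ge0 e0 (sqr_ge0 (enorm (grad f x))).
lra.
Qed.

(** Expanding the square, convexity contributes - 2 eta (f x - fs), and the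
    gradient bound limits the quadratic term to 4 (eta L) eta (f x - fs), where
    L = H0 + H1 (f x - fs); as eta L <= 1 / 6, half of the gain survives. *)
Lemma short_step_dist (R : realType) (d : nat) (H0 H1 : R)
    (f : 'rV[R]_d -> R) (fs eta : R) (x xs : 'rV[R]_d) :
  0 < H0 -> 0 < H1 -> lbound (range f) fs ->
  H0H1_smooth H0 H1 f fs -> convex_grad f -> f xs = fs ->
  0 <= eta -> eta * (H0 + H1 * (f x - fs)) <= 1 / 6 ->
  enorm (x - eta *: grad f x - xs) ^+ 2 <=
    enorm (x - xs) ^+ 2 - eta * (f x - fs).
Proof.
move=> H0p H1p fsl fsm fcv fxs e0 eL.
have F0 : 0 <= f x - fs by rewrite subr_ge0; apply: fsl; exists x.
have gb := sqr_enorm_grad_le x H0p H1p fsl fsm fcv.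
have cv := fcv x xs; rewrite fxs in cv.
have -> : enorm (x - eta *: grad f x - xs) ^+ 2 = enorm (x - xs) ^+ 2
    - 2 * eta * dotv (grad f x) (x - xs) + eta ^+ 2 * enorm (grad f x) ^+ 2.
  rewrite addrAC !sqr_enorm; move: (x - xs) (grad f x) => u g.
  rewrite dotvDr dotvNr dotvZr !(dotvC (u - _)) !dotvDr !dotvNr !dotvZr.
  by rewrite (dotvC u g); ring.
have := ler_wpM2l (sqr_ge0 eta) gb.
have := ler_wpM2r (mulr_ge0 e0 F0) eL.
have := ler_wpM2l e0 cv.
have := mulr_ge0 e0 F0.
lra.
Qed.

Lemma convex_gap_le (R : realType) (d : nat) (f : 'rV[R]_d -> R)
    (x xs : 'rV[R]_d) :
  convex_grad f -> f x - f xs <= enorm (grad f x) * enorm (x - xs).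
Proof. by move=> fcv; apply: (le_trans (fcv x xs)); exact: dotv_le_enorm. Qed.

(** * The warm-up step size *)

Lemma theta_gt0 (R : realType) : 0 < theta R.
Proof.
by rewrite /theta divr_gt0 //; have := sqrtr_ge0 (2 : R); lra.
Qed.

Lemma theta_le (R : realType) : theta R <= 1 / 8.
Proof.
have s1 : 1 <= Num.sqrt 2 :> R by rewrite -[leLHS]sqrtr1 ler_wsqrtr // ler1n.
by rewrite /theta !div1r lef_pV2 ?posrE; lra.
Qed.

Lemma warmup_step_small (R : realType) (H0 H1 Fk : R) :
  0 < H0 -> 0 < H1 -> 0 <= Fk -> Fk < H0 / (3 * H1) ->
  warmup_step H0 H1 Fk = theta R / H0.
Proof.
move=> H0p H1p F0 Flt; rewrite /warmup_step.
case: eqVneq => [_|Fn0]; first by rewrite div1r.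
have Fp : 0 < Fk by rewrite lt_def Fn0.
rewrite ltr_pdivlMr in Flt; last by lra.
rewrite min_l ?div1r // lef_pV2 ?posrE //; first by lra.
by rewrite !mulr_gt0.
Qed.

Lemma warmup_step_large (R : realType) (H0 H1 Fk : R) :
  0 < H0 -> 0 < H1 -> H0 / (3 * H1) <= Fk ->
  warmup_step H0 H1 Fk = theta R / (3 * H1 * Fk).
Proof.
move=> H0p H1p Fge.
have Fp : 0 < Fk by apply: lt_le_trans Fge; rewrite divr_gt0 //; lra.
rewrite /warmup_step gt_eqF //.
rewrite ler_pdivrMr in Fge; last by lra.
rewrite min_r ?div1r // lef_pV2 ?posrE //; first by lra.
by rewrite !mulr_gt0.
Qed.

(** Both bounds amount to theta <= 1 / 8: the step is at most theta / H0 and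
    at most theta / (3 H1 Fk), so that eta (H0 + H1 Fk) <= 4 theta / 3. *)
Lemma warmup_step_bounds (R : realType) (H0 H1 Fk : R) :
  0 < H0 -> 0 < H1 -> 0 <= Fk ->
  [/\ 0 <= warmup_step H0 H1 Fk,
      warmup_step H0 H1 Fk * (H0 + H1 * Fk) <= 1 / 6 &
      warmup_step H0 H1 Fk * H1 * Fk <= 1 / 24].
Proof.
move=> H0p H1p F0; have t0 := theta_gt0 R; have t8 := theta_le R.
have [Fge|Flt] := lerP (H0 / (3 * H1)) Fk.
  rewrite warmup_step_large //.
  have Fp : 0 < Fk by apply: lt_le_trans Fge; rewrite divr_gt0 //; lra.
  have HFp : 0 < H1 * Fk by rewrite mulr_gt0.
  rewrite ler_pdivrMr in Fge; last by lra.
  have eF : theta R / (3 * H1 * Fk) * H1 * Fk = theta R / 3.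
    by field; rewrite !gt_eqF.
  have e0 : 0 <= theta R / (3 * H1 * Fk) by rewrite divr_ge0 ?ltW //; lra.
  split=> //; last by rewrite eF; lra.
  have := ler_wpM2l e0 Fge.
  lra.
rewrite warmup_step_small //.
rewrite ltr_pdivlMr in Flt; last by lra.
have e0 : 0 <= theta R / H0 by rewrite divr_ge0 // ltW.
have eH : theta R / H0 * H0 = theta R by field; rewrite gt_eqF.
have := ler_wpM2l e0 (ltW Flt).
by split=> //; lra.
Qed.

(** * The warm-up time *)

Lemma bigmin_nat_le (N : nat) (P : pred nat) (k : nat) :
  (k < N)%N -> P k -> (\big[minn/N]_(i < N | P i) (i : nat) <= k)%N.
Proof.
move=> kN Pk; pose i0 := Ordinal kN.
suff H r : i0 \in r -> (\big[minn/N]_(i <- r | P i) (i : nat) <= k)%N.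
  exact: H (mem_index_enum i0).
elim: r => // i r IH; rewrite in_cons big_cons => /orP[/eqP <-|/IH le_k].
  by rewrite Pk geq_minl.
by case: ifP => _ //; apply: leq_trans le_k; exact: geq_minr.
Qed.

Lemma bigmin_nat_lt (N : nat) (P : pred nat) :
  (\big[minn/N]_(i < N | P i) (i : nat) < N)%N ->
  P (\big[minn/N]_(i < N | P i) (i : nat)).
Proof.
apply: (big_ind (fun m => (m < N)%N -> P m)) => [|a b Pa Pb|//].
  by rewrite ltnn.
by rewrite /minn; case: ifP.
Qed.

(** * Convergence of gradient descent *)

(** A positive term followed by a nonnegative one forces 0 <= q, which is what
    lets the bounds on consecutive ratios be multiplied. *)
Lemma geometric_decrease (R : realFieldType) (a : nat -> R) (q : R) (m : nat) :
  (forall k, 0 <= a k) ->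
  (forall k, (k < m)%N -> 0 < a k /\ a k.+1 <= q * a k) ->
  a m <= q ^+ m * a 0%N.
Proof.
move=> a0; elim: m => [|m IH] am; first by rewrite expr0 mul1r.
have [amp aSm] := am m (ltnSn m).
have q0 : 0 <= q by rewrite -(pmulr_lge0 _ amp); exact: le_trans (a0 _) aSm.
apply: (le_trans aSm); rewrite exprS -mulrA ler_wpM2l //.
by apply: IH => k km; apply: am; rewrite ltnW.
Qed.

Lemma nonincreasing_from (R : realFieldType) (a : nat -> R) (N : nat) :
  (forall k, (k < N)%N -> a k.+1 <= a k) ->
  forall k l, (k <= l <= N)%N -> a l <= a k.
Proof.
move=> aS k; elim=> [|l IH] /andP[kl lN]; first by move: kl; rewrite leqn0 => /eqP ->.
move: kl; rewrite leq_eqVlt => /orP[/eqP -> //|kl].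
by apply: (le_trans (aS l lN)); rewrite IH // -ltnS kl ltnW.
Qed.

(** The decreases of the potential D telescope, and each of them is at least
    c (a N). *)
Lemma telescoping_rate (R : realFieldType) (a D : nat -> R) (c : R)
    (m N : nat) :
  (m <= N)%N -> 0 <= c -> 0 <= D N ->
  (forall k, (m <= k < N)%N -> c * a k <= D k - D k.+1) ->
  (forall k, (m <= k < N)%N -> a N <= a k) ->
  (N - m)%:R * (c * a N) <= D m.
Proof.
move=> mN c0 DN aD aN.
have : \sum_(m <= k < N) c * a N <= \sum_(m <= k < N) (D k - D k.+1).
  apply: ler_sum_nat => k kmN; apply: le_trans (aD k kmN).
  by rewrite ler_wpM2l // aN.
have -> : \sum_(m <= k < N) (D k - D k.+1) = D m - D N.
  rewrite -[RHS]opprB -telescope_sumr // -sumrN.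
  by apply: eq_bigr => k _; rewrite opprB.
by rewrite sumr_const_nat -mulr_natl; lra.
Qed.

(** Here eta (f x - fs) = theta / (3 H1), so the guaranteed decrease
    (eta / 2) |grad f x|^2, where |grad f x| r >= f x - fs by convexity, is a
    fixed fraction of f x - fs.  If r = 0, the total inverse makes the factor
    equal to 1 and only monotonicity is asserted. *)
Lemma large_gap_contraction (R : realType) (d : nat) (H0 H1 : R)
    (f : 'rV[R]_d -> R) (fs r : R) (x xs : 'rV[R]_d) :
  0 < H0 -> 0 < H1 -> lbound (range f) fs ->
  H0H1_smooth H0 H1 f fs -> convex_grad f -> f xs = fs ->
  enorm (x - xs) <= r -> H0 / (3 * H1) <= f x - fs ->
  f (x - warmup_step H0 H1 (f x - fs) *: grad f x) - fs <=
    (1 - theta R / (6 * H1 * r ^+ 2)) * (f x - fs).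
Proof.
move=> H0p H1p fsl fsm fcv fxs xr Fge.
have Fp : 0 < f x - fs by apply: lt_le_trans Fge; rewrite divr_gt0 //; lra.
have [e0 eL eF] := warmup_step_bounds H0p H1p (ltW Fp).
have dec := short_step_decrease H0p H1p fsl fsm fcv e0 eL eF.
have n0 := enorm_ge0 (grad f x).
have [r0|rn0] := eqVneq r 0.
  rewrite r0 expr0n mulr0 invr0 mulr0 subr0 mul1r.
  by have := mulr_ge0 e0 (sqr_ge0 (enorm (grad f x))); lra.
have rp : 0 < r.
  by rewrite lt_def rn0; exact: le_trans (enorm_ge0 _) xr.
have Fn : f x - fs <= enorm (grad f x) * r.
  rewrite -fxs; apply: (le_trans (convex_gap_le x xs fcv)).
  by rewrite ler_wpM2l.
rewrite warmup_step_large // in dec *.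
have F2 : (f x - fs) ^+ 2 <= enorm (grad f x) ^+ 2 * r ^+ 2.
  by rewrite -exprMn ler_pXn2r ?nnegrE ?mulr_ge0 // ltW.
set F := f x - fs in Fp F2 dec *; set n := enorm (grad f x) in F2 dec *.
have F2' : F ^+ 2 / r ^+ 2 <= n ^+ 2 by rewrite ler_pdivrMr // exprn_gt0.
have c0 : 0 <= theta R / (3 * H1 * F) / 2.
  by rewrite !divr_ge0 ?mulr_ge0 // ltW // theta_gt0.
have := ler_wpM2l c0 F2'.
have -> : theta R / (3 * H1 * F) / 2 * (F ^+ 2 / r ^+ 2)
    = theta R / (6 * H1 * r ^+ 2) * F by field; rewrite !gt_eqF.
move: dec; set q := _ / (_ * _ * F) / 2 * _; set p := theta R / (_ * _ ^+ 2).
by rewrite mulrBl mul1r => dec pq; rewrite {2}/F; lra.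
Qed.

Theorem theoremC18 (R : realType) (d : nat) (H0 H1 : R)
    (f : 'rV[R]_d -> R) (fs : R) (xs : 'rV[R]_d)
    (N : nat) (x : nat -> 'rV[R]_d)
    (H0_gt0 : 0 < H0) (H1_gt0 : 0 < H1)
    (f_diff : forall z : 'rV[R]_d, differentiable f z)
    (fs_min : is_min_value f fs)
    (xs_argmin : argmin f xs)
    (f_smooth : H0H1_smooth H0 H1 f fs)
    (f_convex : convex_grad f) :
  let F := fun k : nat => f (x k) - fs in
  let T := warmup_time H0 H1 F N in
  let r := enorm (x 0%N - xs) in
  gradient_descent f (fun k : nat => warmup_step H0 H1 (F k)) N x ->
  ((T < N)%N ->
     f (x N) - fs <=
       Num.min ((1 - theta R / (6 * H1 * r ^+ 2)) ^+ T * F 0%N)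
               (2 * H0 * r ^+ 2 / (theta R * (N - T)%:R))) /\
  (T = N ->
     f (x N) - fs <= (1 - theta R / (6 * H1 * r ^+ 2)) ^+ N * F 0%N).
Proof.
move=> F T r gd.
have [_ fsl] := fs_min.
have fxs : f xs = fs.
  have [[z _ fz] _] := fs_min; apply/eqP.
  by rewrite eq_le -{1}fz xs_argmin /=; apply: fsl; exists xs.
have F_ge0 k : 0 <= F k by rewrite subr_ge0; apply: fsl; exists (x k).
have F_dec k : (k < N)%N -> F k.+1 <= F k.
  move=> kN; have [e0 eL eF] := warmup_step_bounds H0_gt0 H1_gt0 (F_ge0 k).
  have := short_step_decrease H0_gt0 H1_gt0 fsl f_smooth f_convex e0 eL eF.
  have := mulr_ge0 e0 (sqr_ge0 (enorm (grad f (x k)))).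
  by rewrite -gd // /F; lra.
have D_dec k : (k < N)%N -> enorm (x k.+1 - xs) ^+ 2 <=
    enorm (x k - xs) ^+ 2 - warmup_step H0 H1 (F k) * F k.
  move=> kN; have [e0 eL _] := warmup_step_bounds H0_gt0 H1_gt0 (F_ge0 k).
  rewrite gd //.
  exact: (short_step_dist H0_gt0 H1_gt0 fsl f_smooth f_convex fxs e0 eL).
have x_r k : (k <= N)%N -> enorm (x k - xs) <= r.
  move=> kN; rewrite -(@ler_pXn2r _ 2) ?nnegrE ?enorm_ge0 //.
  apply: (@nonincreasing_from _ (fun k => enorm (x k - xs) ^+ 2) N) => // l lN.
  have [e0 _ _] := warmup_step_bounds H0_gt0 H1_gt0 (F_ge0 l).
  by have := mulr_ge0 e0 (F_ge0 l); have := D_dec l lN; lra.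
have T_le : (T <= N)%N.
  by rewrite /T /warmup_time; elim/big_ind: _ => // [a b aN _|i _];
    [rewrite geq_min aN | exact: ltnW].
(* T is the least index below the threshold, so every earlier gap is large. *)
have before_T k : (k < T)%N -> H0 / (3 * H1) <= F k.
  move=> kT; rewrite leNgt; apply/negP => Flt.
  have := @bigmin_nat_le N (fun k => F k < H0 / (3 * H1)) k
    (leq_trans kT T_le) Flt.
  by rewrite -/(warmup_time H0 H1 F N) leqNgt kT.
have at_T : F T <= (1 - theta R / (6 * H1 * r ^+ 2)) ^+ T * F 0%N.
  apply: geometric_decrease => // k kT; have Fge := before_T k kT.
  have kN := leq_trans kT T_le; split.
    by apply: lt_le_trans Fge; rewrite divr_gt0 // mulr_gt0.
  rewrite /F gd //; apply: (large_gap_contraction H0_gt0 H1_gt0 fsl) fxs _ Fge => //.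
  by apply: x_r; exact: ltnW.
split=> [TN|TN]; last by rewrite -/(F N) -{1 2}TN.
have F_mono := nonincreasing_from F_dec.
have after_T k : (T <= k < N)%N -> F k < H0 / (3 * H1).
  move=> /andP[Tk kN]; apply: (@le_lt_trans _ _ (F T)).
    by apply: F_mono; rewrite Tk ltnW.
  exact: (@bigmin_nat_lt N (fun k => F k < H0 / (3 * H1)) TN).
rewrite le_min; apply/andP; split.
  by apply: le_trans at_T; apply: F_mono; rewrite T_le /=.
have tp := theta_gt0 R.
have c0 : 0 < theta R / H0 by rewrite divr_gt0.
have rate : (N - T)%:R * (theta R / H0 * F N) <= enorm (x T - xs) ^+ 2.
  apply: (@telescoping_rate _ F (fun k => enorm (x k - xs) ^+ 2)) => //.
  - exact: ltW.
  - exact: sqr_ge0.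
  - move=> k kTN; have /andP[Tk kN] := kTN; have := D_dec k kN.
    by rewrite warmup_step_small ?after_T //; lra.
  - by move=> k /andP[Tk kN]; apply: F_mono; rewrite leqnn ltnW.
have Tr : enorm (x T - xs) ^+ 2 <= r ^+ 2.
  by rewrite ler_pXn2r ?nnegrE ?enorm_ge0 // x_r.
have NT : 0 < (N - T)%:R :> R by rewrite ltr0n subn_gt0.
rewrite ler_pdivlMr ?mulr_gt0 //.
have -> : (f (x N) - fs) * (theta R * (N - T)%:R)
    = H0 * ((N - T)%:R * (theta R / H0 * F N)).
  by rewrite /F; field; rewrite gt_eqF.
have := ler_wpM2l (ltW H0_gt0) (le_trans rate Tr).
by have := mulr_ge0 (ltW H0_gt0) (sqr_ge0 r); lra.
Qed.
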